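(* Let $1\le k\le n$, let $A=A(x)\in\mathbb{C}^{n\times n}$ be a matrix function of $x$, and let $\mathfrak{i}\subset\{1,\ldots,n\}$ be any multi-index of cardinality $k$. Let $a,b,c,d$ denote respectively the $\mathfrak{i}\times\mathfrak{i}$, $\mathfrak{i}\times\mathfrak{i}^\circ$, $\mathfrak{i}^\circ\times\mathfrak{i}$ and $\mathfrak{i}^\circ\times\mathfrak{i}^\circ$ submatrices of $A(x)$. Suppose that $\hat y=\hat y(x)\in\mathbb{C}^{(n-k)\times k}$ satisfies the Riccati flow \[ \hat y'=c(x)+d(x)\,\hat y-\hat y\,a(x)-\hat y\,b(x)\,\hat y \] and that $u=u(x)\in\mathbb{U}(k)$ (the group of unitary $k\times k$ matrices) satisfies \[ u'=-\hat y^\dagger\,(c+d\,\hat y)\,u . \] Let $y_{\mathfrak{i}^\circ}$ be the $n\times k$ matrix whose submatrix of rows indexed by $\mathfrak{i}$ is $I_k$ and whose submatrix of rows indexed by $\mathfrak{i}^\circ$ is $\hat y$. Then $Q=y_{\mathfrak{i}^\circ}u$ satisfies the Drury--Oja flow \[ Q'=(I_n-QQ^\dagger)\,A\,Q . \]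
   Context: $\mathfrak{i}^\circ=\{1,\ldots,n\}\setminus\mathfrak{i}$. For index sets $\mathfrak{p},\mathfrak{q}$, the $\mathfrak{p}\times\mathfrak{q}$ submatrix of a matrix consists of the entries with row index in $\mathfrak{p}$ and column index in $\mathfrak{q}$ (indices in increasing order). $\dagger$ denotes conjugate transpose, and the prime denotes $d/dx$. *)

(* Defs.v *)
From HB Require Import structures.
From mathcomp Require Import all_boot all_order all_algebra.
From mathcomp Require Import complex.
From mathcomp Require Import all_classical all_reals all_analysis.
Import Order.TTheory GRing.Theory Num.Theory numFieldNormedType.Exports.

Set Implicit Arguments.
Unset Strict Implicit.
Unset Printing Implicit Defensive.

Local Open Scope ring_scope.

Lemma card_setC (n k : nat) (I : {set 'I_n}) :
  #|I| = k -> #|~: I| = (n - k)%N.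
Proof. by move=> <-; rewrite cardsCs finset.setCK card_ord. Qed.

(* The j-th element, in increasing order, of an index set of cardinality k.
   [enum_val] follows the enumeration of 'I_n, which is increasing; see
   [idx_lt] and [idx_codom]. *)
Definition idx (n k : nat) (I : {set 'I_n}) (hI : #|I| = k) (j : 'I_k) : 'I_n :=
  enum_val (cast_ord (esym hI) j).

Lemma idx_lt (n k : nat) (I : {set 'I_n}) (hI : #|I| = k) (i j : 'I_k) :
  (i < j)%N -> (idx hI i < idx hI j)%N.
Proof.
move=> ij; rewrite /idx.
set i' := cast_ord _ i; set j' := cast_ord _ j.
rewrite (enum_val_nth (enum_val i') i') (enum_val_nth (enum_val i') j').
have sI : sorted (fun p q : 'I_n => (p < q)%N) (enum I).
  rewrite /enum_mem; apply: sorted_filter.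
    by move=> ? ? ?; apply: ltn_trans.
  rewrite -enumT -(sorted_map (f := val) (e' := ltn)) val_enum_ord.
  exact: iota_ltn_sorted.
apply: (sorted_ltn_nth _ _ sI) => //; first by move=> ? ? ?; apply: ltn_trans.
- by rewrite inE -cardE.
- by rewrite inE -cardE.
Qed.

Lemma idx_codom (n k : nat) (I : {set 'I_n}) (hI : #|I| = k) (p : 'I_n) :
  reflect (exists j, idx hI j = p) (p \in I).
Proof.
apply: (iffP idP) => [pI|[j <-]]; last exact: enum_valP.
exists (cast_ord hI (enum_rank_in pI p)).
by rewrite /idx cast_ordK enum_rankK_in.
Qed.

(* F'(x) = L for a complex matrix function F of a real variable: every entry
   is differentiated through its real and imaginary parts. *)
Definition is_cmx_derive (R : realType) (m n : nat)
    (F : R -> 'M[R[i]]_(m, n)) (x : R) (L : 'M[R[i]]_(m, n)) : Prop :=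
  forall p q,
    is_derive x (1 : R) (fun t : R => complex.Re (F t p q))
      (complex.Re (L p q)) /\
    is_derive x (1 : R) (fun t : R => complex.Im (F t p q))
      (complex.Im (L p q)).

(* Main.v *)
(* Write [y = y_{I°}]. Since [u] is unitary, [Q Q^t* = y y^t*], so the right-hand
   side is [(A y - y (y^t* A y)) u]. As the rows of [y] indexed by [I] and [I°]
   are [1] and [yhat],
   [y^t* A y = (a + b yhat) + yhat^t* (c + d yhat)].
   The rows [I] of the right-hand side are thus [- yhat^t* (c + d yhat) u = u'],
   and the rows [I°] are [(yhat' - yhat yhat^t* (c + d yhat)) u = (yhat u)']. *)

Require Import Defs.
From mathcomp Require Import all_boot all_order all_algebra.
From mathcomp Require Import complex ring.
From mathcomp Require Import all_classical all_reals all_analysis.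
Import Order.TTheory GRing.Theory Num.Theory numFieldNormedType.Exports.
Set Implicit Arguments.
Unset Strict Implicit.
Unset Printing Implicit Defensive.
Local Open Scope ring_scope.
Local Open Scope sesquilinear_scope.

Lemma sum_idx (V : nmodType) (n k : nat) (I : {set 'I_n}) (hI : #|I| = k)
    (F : 'I_n -> V) :
  \sum_(q in I) F q = \sum_(j < k) F (idx hI j).
Proof.
(* Once [k] is [#|I|] itself, the cast inside [idx] is the identity. *)
by subst k; rewrite big_enum_val; apply: eq_bigr => j _; rewrite /idx cast_ord_id.
Qed.

(** Splitting the inner sum over [I] and its complement gives block multiplication for an arbitrary
    index set, with no permutation moving [I] to the front. *)
Lemma mulmx_idx (S : pzSemiRingType) (n k m p : nat) (I : {set 'I_n})
    (hI : #|I| = k) (M : 'M[S]_(m, n)) (N : 'M[S]_(n, p)) :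
  M *m N = colsub (idx hI) M *m rowsub (idx hI) N +
    colsub (idx (card_setC hI)) M *m rowsub (idx (card_setC hI)) N.
Proof.
apply/matrixP => i j; rewrite !mxE (bigID (mem I)) /=; congr (_ + _).
  by rewrite (sum_idx hI); apply: eq_bigr => l _; rewrite !mxE.
rewrite (eq_bigl (fun q => q \in ~: I)) => [|q]; last by rewrite inE.
by rewrite (sum_idx (card_setC hI)); apply: eq_bigr => l _; rewrite !mxE.
Qed.

Section ComplexMatrixDerivative.
Variable R : realType.

(** Serves to replace the row blocks of [Q] by [u] and [yhat u], with which they agree only on
    [D]. *)
Lemma near_eq_is_cmx_derive (m n : nat) (F G : R -> 'M[R[i]]_(m, n)) (x : R)
    (L : 'M[R[i]]_(m, n)) :
  (\forall t \near x, F t = G t) -> is_cmx_derive F x L -> is_cmx_derive G x L.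
Proof.
move=> FG dF p q; have [dRe dIm] := dF p q; split.
- by apply: near_eq_is_derive dRe; apply: filterS FG => t ->.
- by apply: near_eq_is_derive dIm; apply: filterS FG => t ->.
Qed.

(** Differentiation is entrywise and each row index lies in [I] or in its complement, so the two row
    blocks can be treated separately. *)
Lemma is_cmx_derive_rowsub (n k m : nat) (I : {set 'I_n}) (hI : #|I| = k)
    (F : R -> 'M[R[i]]_(n, m)) (x : R) (L : 'M[R[i]]_(n, m)) :
  is_cmx_derive (fun t => rowsub (idx hI) (F t)) x (rowsub (idx hI) L) ->
  is_cmx_derive (fun t => rowsub (idx (card_setC hI)) (F t)) x
    (rowsub (idx (card_setC hI)) L) ->
  is_cmx_derive F x L.
Proof.
move=> dr drc p q; have [/(idx_codom hI)[j <-]|pI] := boolP (p \in I).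
  by have := dr j q; rewrite mxE; under eq_fun do rewrite mxE;
     under [X in _ /\ is_derive _ _ X _]eq_fun do rewrite mxE.
have /(idx_codom (card_setC hI))[j <-] : p \in ~: I by rewrite inE.
by have := drc j q; rewrite mxE; under eq_fun do rewrite mxE;
   under [X in _ /\ is_derive _ _ X _]eq_fun do rewrite mxE.
Qed.

(** The real and imaginary parts of each entry are sums of products of real functions, so the real
    Leibniz rule applies term by term. *)
Lemma is_cmx_deriveM (m n p : nat) (F : R -> 'M[R[i]]_(m, n))
    (G : R -> 'M[R[i]]_(n, p)) (x : R) (dF : 'M[R[i]]_(m, n))
    (dG : 'M[R[i]]_(n, p)) :
  is_cmx_derive F x dF -> is_cmx_derive G x dG ->
  is_cmx_derive (fun t => F t *m G t) x (dF *m G x + F x *m dG).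
Proof.
have ReD : {morph @complex.Re R : z w / z + w} by case=> ? ? [].
have ImD : {morph @complex.Im R : z w / z + w} by case=> ? ? [].
have ReM (z w : R[i]) : complex.Re (z * w) =
  complex.Re z * complex.Re w - complex.Im z * complex.Im w by case: z w => ? ? [].
have ImM (z w : R[i]) : complex.Im (z * w) =
  complex.Re z * complex.Im w + complex.Im z * complex.Re w by case: z w => ? ? [].
move=> hF hG i j; rewrite !mxE -big_split /=; split.
- rewrite (big_morph _ ReD (erefl _)).
  have -> : (fun t => complex.Re ((F t *m G t) i j)) = \sum_(l < n)
      ((fun t => complex.Re (F t i l)) * (fun t => complex.Re (G t l j)) -
       (fun t => complex.Im (F t i l)) * (fun t => complex.Im (G t l j))).
    apply/funext => t; rewrite mxE (big_morph _ ReD (erefl _)) fct_sumE.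
    by apply: eq_bigr => l _; rewrite ReM.
  apply: is_derive_sum => l; have [FR FI] := hF i l; have [GR GI] := hG l j.
  apply: is_derive_eq; rewrite ReD !ReM /GRing.scale /=; ring.
- rewrite (big_morph _ ImD (erefl _)).
  have -> : (fun t => complex.Im ((F t *m G t) i j)) = \sum_(l < n)
      ((fun t => complex.Re (F t i l)) * (fun t => complex.Im (G t l j)) +
       (fun t => complex.Im (F t i l)) * (fun t => complex.Re (G t l j))).
    apply/funext => t; rewrite mxE (big_morph _ ImD (erefl _)) fct_sumE.
    by apply: eq_bigr => l _; rewrite ImM.
  apply: is_derive_sum => l; have [FR FI] := hF i l; have [GR GI] := hG l j.
  apply: is_derive_eq; rewrite ImD !ImM /GRing.scale /=; ring.
Qed.

End ComplexMatrixDerivative.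

Theorem lemma1 (R : realType) (n k : nat) (hk : (1 <= k)%N) (hkn : (k <= n)%N)
    (I : {set 'I_n}) (hI : #|I| = k)
    (D : set R) (hD : open D)
    (A : R -> 'M[R[i]]_n)
    (yhat : R -> 'M[R[i]]_(n - k, k))
    (u : R -> 'M[R[i]]_k)
    (y : R -> 'M[R[i]]_(n, k)) :
  let r := idx hI in
  let rc := idx (card_setC hI) in
  let a x := mxsub r r (A x) in
  let b x := mxsub r rc (A x) in
  let c x := mxsub rc r (A x) in
  let d x := mxsub rc rc (A x) in
  (forall x, D x ->
     is_cmx_derive yhat x
       (c x + d x *m yhat x - yhat x *m a x - yhat x *m b x *m yhat x)) ->
  (forall x, D x -> u x \is unitarymx) ->
  (forall x, D x ->
     is_cmx_derive u x
       (- ((yhat x)^t* *m (c x + d x *m yhat x) *m u x))) ->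
  (forall x, D x -> rowsub r (y x) = 1%:M) ->
  (forall x, D x -> rowsub rc (y x) = yhat x) ->
  let Q x := y x *m u x in
  forall x, D x ->
    is_cmx_derive Q x ((1%:M - Q x *m (Q x)^t*) *m A x *m Q x).
Proof.
move=> r rc a b c d dyhat u_unit du yr yrc Q x Dx.
set yx := y x; set ux := u x.
(* Since [D] is open, the row identities for [y] hold on a neighbourhood of [x], as differentiating
   them requires. *)
have nearD : \forall t \near x, D t by exact: open_nbhs_nbhs.
have Ay_r : rowsub r (A x *m yx) = a x + b x *m yhat x.
  rewrite -mul_rowsub_mx (mulmx_idx hI) -/r -/rc yr // yrc // mulmx1.
  by rewrite -!mxsub_comp.
have Ay_rc : rowsub rc (A x *m yx) = c x + d x *m yhat x.
  rewrite -mul_rowsub_mx (mulmx_idx hI) -/r -/rc yr // yrc // mulmx1.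
  by rewrite -!mxsub_comp.
have yAy : yx^t* *m (A x *m yx) =
    (a x + b x *m yhat x) + (yhat x)^t* *m (c x + d x *m yhat x).
  (* The column blocks of [yx^t*] are the conjugate transposes of the row blocks of [yx], that is,
     [1] and [(yhat x)^t*]. *)
  rewrite (mulmx_idx hI) -/r -/rc Ay_r Ay_rc -map_mxsub -trmx_mxsub yr //.
  rewrite -map_mxsub -trmx_mxsub yrc //.
  by rewrite trmx1 map_mx1 mul1mx.
have -> : (1%:M - Q x *m (Q x)^t*) *m A x *m Q x =
    (A x *m yx - yx *m (yx^t* *m (A x *m yx))) *m ux.
  have -> : Q x *m (Q x)^t* = yx *m yx^t*.
    rewrite /Q trmx_mul map_mxM mulmxA -(mulmxA (y x)).
    (* Unitarity enters as [u u^t* = 1], cancelling the middle of [y u u^t* y^t*]. *)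
    by rewrite (unitarymxP (u_unit x Dx)) mulmx1.
  by rewrite !mulmxBl mul1mx /Q !mulmxA.
apply: (is_cmx_derive_rowsub (hI := hI)); rewrite -/r -/rc.
(* On the rows [I], [Q] is [u]; the term [a + b yhat] cancels and the equation for [u'] remains. *)
- apply: (@near_eq_is_cmx_derive _ _ _ u).
    near=> t; rewrite /Q -mul_rowsub_mx yr ?mul1mx //.
    by near: t.
  rewrite -mul_rowsub_mx linearB /= -[rowsub r (yx *m _)]mul_rowsub_mx yr // mul1mx yAy Ay_r.
  by rewrite opprD addrA subrr sub0r mulNmx; exact: du.
- apply: (@near_eq_is_cmx_derive _ _ _ (fun t => yhat t *m u t)).
    near=> t; rewrite /Q -mul_rowsub_mx yrc //.
    by near: t.
  rewrite -mul_rowsub_mx linearB /= -[rowsub rc (yx *m _)]mul_rowsub_mx yrc // yAy Ay_rc.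
  (* Distributing [yhat] exposes the Leibniz form: the Riccati right-hand side times [u], plus
     [yhat] times [u']. *)
  suff -> : (c x + d x *m yhat x - yhat x *m (a x + b x *m yhat x +
      (yhat x)^t* *m (c x + d x *m yhat x))) *m ux =
    (c x + d x *m yhat x - yhat x *m a x - yhat x *m b x *m yhat x) *m u x +
    yhat x *m - ((yhat x)^t* *m (c x + d x *m yhat x) *m u x).
    by apply: is_cmx_deriveM; [exact: dyhat | exact: du].
  rewrite mulmxN !mulmxA -mulmxBl; congr (_ *m _).
  by rewrite (mulmxDr (yhat x)) (mulmxDr (yhat x)) !opprD !mulmxA !addrA.
Unshelve. all: by end_near.
Qed.
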